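(* Given nonnegative integers $Y_1,\ldots,Y_n$ with mean $\bar{Y}_n=n^{-1}\sum_{i=1}^nY_i$, let $(\hat\mu,\hat p)$ denote a maximum likelihood estimate of $(\mu,p)$ for the extended negative binomial distribution with parameters $\mu\in[0,\infty)$ and $p\in(0,1]$. Then: (i) $\hat\mu=0$ if and only if $\bar{Y}_n=0$; (ii) we always have $\hat\mu=\bar{Y}_n$; (iii) if $Y_1,\ldots,Y_n$ are i.i.d. Poisson$(\lambda)$ with $\lambda>0$ (the first $n$ terms of an i.i.d. sequence), then $\lim_{n\to\infty}\hat p=1$ with probability $1$.
   Context: The extended negative binomial distribution with parameters $(\mu,p)\in[0,\infty)\times(0,1]$ is the distribution on $\{0,1,2,\ldots\}$ with probability mass function $f_{\mu,p}$ defined as follows. For $\mu>0$ and $p\in(0,1)$: $$f_{\mu,p}(y)=\frac{\Gamma\left(\frac{\mu p}{1-p}+y\right)}{\Gamma\left(\frac{\mu p}{1-p}\right)\Gamma(y+1)}\,p^{\frac{\mu p}{1-p}}(1-p)^y,\quad y=0,1,2,\ldots$$ For $\mu=0$ and $p\in(0,1]$: $f_{0,p}(0)=1$ and $f_{0,p}(y)=0$ for $y\ge1$. For $\mu>0$ and $p=1$: $f_{\mu,1}(y)=\frac{\mu^y}{y!}e^{-\mu}$, $y=0,1,2,\ldots$ (the Poisson$(\mu)$ distribution). A maximum likelihood estimate (MLE) of $(\mu,p)$ given $Y_1,\ldots,Y_n$ is a maximizer of $l(\mu,p)=\sum_{i=1}^n\log f_{\mu,p}(Y_i)$ (with $\log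 0=-\infty$) over $(\mu,p)\in[0,\infty)\times(0,1]$. Poisson$(\lambda)$ has probability mass function $\frac{\lambda^y}{y!}e^{-\lambda}$, $y=0,1,2,\ldots$. *)

(* Defs.v *)
From HB Require Import structures.
From mathcomp Require Import all_boot all_order all_algebra.
From mathcomp Require Import finmap.
From mathcomp Require Import all_classical all_reals all_analysis.

Set Implicit Arguments.
Unset Strict Implicit.
Unset Printing Implicit Defensive.
Import Order.TTheory GRing.Theory Num.Theory.
Import numFieldNormedType.Exports.

Local Open Scope classical_set_scope.
Local Open Scope ring_scope.

(* Euler's integral; only meaningful for 0 < x. *)
Definition Gamma (R : realType) (x : R) : R :=
  \int[lebesgue_measure]_(t in `]0, +oo[) (t `^ (x - 1) * expR (- t)).

(* Intended domain: 0 <= mu and 0 < p <= 1. The test mu == 0 comes first since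
   the library's poisson_pmf is the Poisson mass function only for a positive
   rate. *)
Definition enb_pmf (R : realType) (mu p : R) (y : nat) : R :=
  if mu == 0 then (y == 0%N)%:R
  else if p == 1 then poisson_pmf mu y
  else let r := mu * p / (1 - p) in
    Gamma (r + y%:R) / (Gamma r * Gamma (y%:R + 1)) * p `^ r * (1 - p) ^+ y.

(* lne is -oo at 0, so a sample of probability 0 has log-likelihood -oo. *)
Definition enb_loglik (R : realType) (n : nat) (Y : 'I_n -> nat) (mu p : R)
    : \bar R :=
  (\sum_(i < n) lne (enb_pmf mu p (Y i))%:E)%E.

Definition enb_param (R : realType) (mu p : R) : Prop :=
  0 <= mu /\ 0 < p <= 1.

Definition is_enb_mle (R : realType) (n : nat) (Y : 'I_n -> nat) (mu p : R)
    : Prop :=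
  enb_param mu p /\
  forall mu' p' : R, enb_param mu' p' ->
    (enb_loglik Y mu' p' <= enb_loglik Y mu p)%E.

Definition sample_mean (R : realType) (n : nat) (Y : 'I_n -> nat) : R :=
  n%:R^-1 * \sum_(i < n) (Y i)%:R.

Definition mutually_independent (R : realType) (d d' : measure_display)
    (Omega : measurableType d) (T : measurableType d')
    (P : probability Omega R) (X : nat -> {RV P >-> T}) : Prop :=
  forall (I : {fset nat}) (A : nat -> set T),
    (forall i, i \in I -> measurable (A i)) ->
    P (\bigcap_(i in [set` I]) (X i @^-1` A i)) =
    (\prod_(i <- I) P (X i @^-1` A i))%E.

Definition iid_poisson (R : realType) (d : measure_display)
    (Omega : measurableType d) (P : probability Omega R) (lambda : R)
    (X : nat -> {RV P >-> nat}) : Prop :=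
  mutually_independent X /\
  forall i y, distribution P (X i) [set y] = (poisson_pmf lambda y)%:E.

(* Main.v *)
(* The mean. Along a curve of constant r = mu p / (1 - p) the Gamma factors of the
   likelihood do not change, and n r ln p + S ln (1 - p), with S the sum of the
   sample, is strictly maximal at mu = S / n; at p = 1 the same holds for
   S ln mu - n mu.

   The limit of phat. The maximum likelihood estimate is at least as likely as
   Poisson(lambda), with masses g. Bounding ln (f / g) by 2 (sqrt (f / g) - 1) on
   {0, .., K-1} and by - ln g beyond, the strong law for the frequencies and for
   the tails of - ln g shows that the squared Hellinger distance on {0, .., K-1}
   between the fitted masses f and g is eventually at most a tail of the entropy
   plus the mass of g beyond K. So f converges to g pointwise, and phat can be
   read off from f 0, f 1, f 2. *)
Require Import Defs.
From HB Require Import structures.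
From mathcomp Require Import all_boot all_order all_algebra.
From mathcomp Require Import finmap ring lra.
From mathcomp Require Import all_classical all_reals all_analysis.
From mathcomp Require Import measurable_realfun.

Set Implicit Arguments.
Unset Strict Implicit.
Unset Printing Implicit Defensive.
Import Order.TTheory GRing.Theory Num.Theory.
Import numFieldNormedType.Exports.

Local Open Scope classical_set_scope.
Local Open Scope ring_scope.

(** * Euler's Gamma function *)

Section EulerGamma.
Variable R : realType.
Implicit Types x t : R.
Local Notation mu := (@lebesgue_measure R).

Definition gamma_fun x t : R := t `^ (x - 1) * expR (- t).

(** Extended real values allow the functional equation to be proved before finiteness is known;
    [Gamma] is [fine] of this. *)
Definition eGamma x : \bar R := (\int[mu]_(t in `]0%R, +oo[) (gamma_fun x t)%:E)%E.

Lemma gamma_fun_ge0 x t : 0 <= gamma_fun x t.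
Proof. by rewrite mulr_ge0 ?powR_ge0 ?expR_ge0. Qed.

Lemma continuous_expRN : continuous (fun t : R => expR (- t)).
Proof.
by move=> t; apply: continuous_comp; [exact: opp_continuous|exact: continuous_expR].
Qed.

Lemma continuous_powR_gt0 (s t : R) : 0 < t -> {for t, continuous (@powR R ^~ s)}.
Proof.
move=> t0; apply/differentiable_continuous/derivable1_diffP.
by apply: derivable_powR; rewrite in_itv/= t0.
Qed.

Lemma measurable_gamma_fun x D : measurable D -> measurable_fun D (gamma_fun x).
Proof.
move=> mD; apply: measurable_funM.
  by apply: measurable_funTS; exact: measurable_powR.
by apply: measurable_funTS; exact: (continuous_measurable_fun continuous_expRN).
Qed.

Lemma eGamma_ge0 x : (0 <= eGamma x)%E.
Proof. by apply: integral_ge0 => t _; rewrite lee_fin gamma_fun_ge0. Qed.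

(** Compact segments exhausting the half-line, so that integration by parts applies; the [+ 1] at
    the right end keeps the segment nondegenerate for [n = 0]. *)
Let I (n : nat) : set R := `[n.+1%:R^-1, n.+1%:R + 1].

Let bigcupI : \bigcup_n I n = `]0, +oo[%classic.
Proof.
apply/seteqP; split => [t [n _]|t].
  rewrite /I /= !in_itv/= andbT => /andP[+ _].
  by apply: lt_le_trans; rewrite invr_gt0.
rewrite /= in_itv/= andbT => t0.
pose n := Num.truncn (Num.max t^-1 t).
have n_gt : Num.max t^-1 t < n.+1%:R by rewrite truncnS_gt.
exists n => //; rewrite /I /= in_itv/=; apply/andP; split.
  rewrite -[leRHS]invrK lef_pV2 ?posrE ?invr_gt0//.
  by apply: ltW; apply: le_lt_trans n_gt; rewrite le_max lexx.
apply: (@le_trans _ _ n.+1%:R); last by rewrite lerDl.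
by apply: ltW; apply: le_lt_trans n_gt; rewrite le_max lexx orbT.
Qed.

Let ndI : nondecreasing_seq I.
Proof.
move=> m n mn; apply/subsetPset; rewrite /I; apply: subset_itv; rewrite bnd_simp.
  by rewrite lef_pV2 ?posrE// ler_nat.
by rewrite lerD2r ler_nat.
Qed.

Let cvg_eGamma x :
  (\int[mu]_(t in I n) (gamma_fun x t)%:E)%E @[n --> \oo] --> eGamma x.
Proof.
rewrite /eGamma -bigcupI; apply: ge0_nondecreasing_set_cvg_integral => //.
- by move=> i; exact: measurable_itv.
- move=> i; apply/measurable_EFinP; apply: measurable_gamma_fun.
  exact: measurable_itv.
- by move=> i t _; rewrite lee_fin gamma_fun_ge0.
Qed.

Lemma powR_expRN_cvg0 x : t `^ x * expR (- t) @[t --> +oo] --> (0 : R).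
Proof.
have [N xN] : exists N : nat, x <= N%:R.
  by exists (Num.truncn x).+1; rewrite ltW// truncnS_gt.
(* For [t >= 1] one has [t ^ x * t <= t ^ (N + 1)], and the Taylor term of degree [N + 1] is below
   [expR t]; hence the majorant. *)
apply: (@squeeze_cvgr _ _ _ _ (cst 0) (fun t => N.+1`!%:R * t^-1)); last 2 first.
- exact: cvg_cst.
- rewrite -(mulr0 (N.+1`!%:R : R)); apply: cvgM; first exact: cvg_cst.
  apply/(gtr0_cvgV0 (f := id)); last exact: cvg_id.
  by apply: nbhs_pinfty_gt; rewrite num_real.
near=> t.
have t1 : 1 <= t by near: t; exact: nbhs_pinfty_ge.
have t0 : 0 < t by exact: lt_le_trans t1.
rewrite mulr_ge0 ?powR_ge0 ?expR_ge0//=.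
rewrite expRN ler_pdivrMr ?expR_gt0// mulrAC ler_pdivlMr//.
apply: (@le_trans _ _ (t ^+ N.+1)).
  rewrite exprSr ler_wpM2r ?(ltW t0)// -powR_mulrn ?(ltW t0)//.
  exact: ler_powR.
rewrite mulrC -ler_pdivrMr ?ltr0n ?fact_gt0//.
by apply: le_trans (expR_ge1Dxn N (ltW t0)); rewrite lerDr.
Unshelve. all: by end_near. Qed.

(** Integration by parts of [t ^ x] against the antiderivative [- expR (- t)]; the real summand is
    the boundary term. *)
Let eGamma_parts x (n : nat) : 0 < x ->
  (\int[mu]_(t in I n) (gamma_fun (x + 1) t)%:E =
   (- ((n.+1%:R + 1) `^ x * expR (- (n.+1%:R + 1))) +
     n.+1%:R^-1 `^ x * expR (- n.+1%:R^-1))%:E +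
   x%:E * \int[mu]_(t in I n) (gamma_fun x t)%:E)%E.
Proof.
move=> x0; set a : R := n.+1%:R^-1; set b : R := n.+1%:R + 1.
have a0 : 0 < a by rewrite invr_gt0.
have ab : a < b.
  apply: (@le_lt_trans _ _ 1); first by rewrite invf_le1// ler1n.
  by rewrite ltrDr.
have pos t : t \in `]a, b[ -> 0 < t.
  by rewrite in_itv/= => /andP[+ _]; exact: lt_trans.
have b0 : 0 < b := lt_trans a0 ab.
have posc t : t \in `[a, b] -> 0 < t.
  by rewrite in_itv/= => /andP[+ _]; exact: lt_le_trans.
have -> : (\int[mu]_(t in I n) (gamma_fun (x + 1) t)%:E)%E =
    (\int[mu]_(t in `[a, b]) (t `^ x * expR (- t))%:E)%E.
  by apply: eq_integral => t _; rewrite /gamma_fun addrK.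
rewrite (@integration_by_parts R (fun t => t `^ x) (fun t => - expR (- t))
  (fun t => x * t `^ (x - 1)) (fun t => expR (- t)) a b ab).
- congr (_%:E + _)%E; first by rewrite !mulrN opprK.
  rewrite -ge0_integralZl//; last 4 first.
  + exact: measurable_itv.
  + by apply/measurable_EFinP; apply: measurable_gamma_fun; exact: measurable_itv.
  + by move=> t _; rewrite lee_fin gamma_fun_ge0.
  + by rewrite lee_fin ltW.
  have -> : (\int[mu]_(t in `[a, b]) (x * t `^ (x - 1) * - expR (- t))%:E =
      \int[mu]_(t in `[a, b]) - (x%:E * (gamma_fun x t)%:E))%E.
    by apply: eq_integral => t _; rewrite mulrN EFinN -EFinM /gamma_fun mulrA.
  rewrite integral_ge0N ?oppeK// => t _.
  by rewrite -EFinM lee_fin mulr_ge0 ?gamma_fun_ge0// ltW.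
- apply: continuous_in_subspaceT => t /set_mem/posc t0.

  by apply: cvgM; [exact: cvg_cst|exact: continuous_powR_gt0].
- split.
  + move=> t /pos t0; apply: derivable_powR; by rewrite in_itv/= t0.
  + by apply: cvg_at_right_filter; exact: continuous_powR_gt0.
  + by apply: cvg_at_left_filter; exact: continuous_powR_gt0.
- by move=> t /pos t0; rewrite powR_derive1// in_itv/= t0.
- exact/continuous_subspaceT/continuous_expRN.
- split.
  + by move=> t _; exact: ex_derive.
  + by apply: cvg_at_right_filter; apply: cvgN; exact: continuous_expRN.
  + by apply: cvg_at_left_filter; apply: cvgN; exact: continuous_expRN.
- move=> t _; rewrite derive1_comp// derive1N// derive1_id mulN1r derive1_comp//.
  rewrite derive1N// derive1_id derive1E.
  have /funeqP -> := @derive_expR R.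
  by rewrite mulrN1 opprK.
Qed.

(** Limit of [eGamma_parts] by monotone convergence on both sides, valid even if a side were
    infinite. *)
Lemma eGammaDr1 x : 0 < x -> eGamma (x + 1) = (x%:E * eGamma x)%E.
Proof.
move=> x0; rewrite -[RHS]add0e.
apply: (cvg_unique _ (cvg_eGamma (x := x + 1))) => //=.
under eq_cvg do rewrite eGamma_parts//.
apply: cvgeD; first by rewrite fin_num_adde_defr.
  apply: cvg_EFin; first exact: nearW.
  (* The boundary term at the right end vanishes by exponential decay, the one at the left end
     because [x > 0]. *)
  rewrite -[X in _ --> X](addr0 0); apply: cvgD.
    rewrite -oppr0; apply: cvgN.
    apply: (cvg_comp (fun n : nat => n.+1%:R + 1) _ _ (powR_expRN_cvg0 x)).
    apply/cvgryPge => A; near=> n.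
    apply: (@le_trans _ _ n%:R); last by rewrite -natr1 -addrA lerDl addr_ge0.
    near: n; exact: nbhs_infty_ger.
  apply: (@squeeze_cvgr _ _ _ _ (cst 0) (fun n : nat => n.+1%:R^-1 `^ x)).
  - near=> n; rewrite mulr_ge0 ?powR_ge0 ?expR_ge0//= ger_pMr ?powR_gt0 ?invr_gt0//.
  - exact: cvg_cst.
  - apply: (cvg_comp (fun n : nat => n.+1%:R^-1) _ _ (powR_cvg0 x0)).
    move=> A [e /= e0 Ae].
    have [N _ NP] := cvgr0_norm_lt _ (@cvg_harmonic R) e e0.
    exists N => // n /NP /= ne.
    by apply: Ae; rewrite /= ?sub0r ?normrN// ?invr_gt0.
by apply: cvgeZl => //; exact: cvg_eGamma.
Unshelve. all: by end_near. Qed.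

(** At [x = 1] the integrand is the exponential density of rate 1, of total mass 1. *)
Lemma eGamma1 : eGamma 1 = 1%E.
Proof.
rewrite /eGamma integral_itv_obnd_cbnd; last first.
  apply/measurable_EFinP; apply: measurable_gamma_fun; exact: measurable_itv.
rewrite -(integral_exponential_pdf (ltr01 : 0 < 1 :> R)) /exponential_pdf.
rewrite [LHS]integral_mkcond; apply: eq_integral => t _.
rewrite !patchE; case: ifP => // _.
by rewrite /gamma_fun subrr powRr0 mulN1r.
Qed.

Lemma eGamma_natS n : eGamma n.+1%:R = n`!%:R%:E.
Proof.
elim: n => [|n ih]; first exact: eGamma1.
by rewrite -natr1 eGammaDr1 ?ltr0n// ih -EFinM -natrM factS.
Qed.

(** The functional equation carries an infinite value from [x] to [x + 1], so [x + 1] suffices;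
    there the exponent is positive, [t ^ x <= 1 + t ^ N], and the majorant integrates to
    factorials. *)
Lemma eGamma_lty x : 0 < x -> (eGamma x < +oo)%E.
Proof.
move=> x0; rewrite ltey; apply/eqP => Gy; suff: (eGamma (x + 1) < +oo)%E.
  by rewrite eGammaDr1// Gy gt0_muley.
have [N xN] : exists N : nat, x <= N%:R.
  by exists (Num.truncn x).+1; rewrite ltW// truncnS_gt.
apply: (@le_lt_trans _ _ (eGamma 1 + eGamma N.+1%:R)%E); last first.
  by rewrite eGamma1 eGamma_natS ltry.
rewrite /eGamma -ge0_integralD//; last 4 first.
- by move=> t _; rewrite lee_fin gamma_fun_ge0.
- by apply/measurable_EFinP; apply: measurable_gamma_fun; exact: measurable_itv.
- by move=> t _; rewrite lee_fin gamma_fun_ge0.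
- by apply/measurable_EFinP; apply: measurable_gamma_fun; exact: measurable_itv.
apply: ge0_le_integral => //.
- by move=> t _; rewrite lee_fin gamma_fun_ge0.
- by apply/measurable_EFinP; apply: measurable_gamma_fun; exact: measurable_itv.
- by apply: emeasurable_funD; apply/measurable_EFinP; apply: measurable_gamma_fun;
    exact: measurable_itv.
move=> t; rewrite /= in_itv/= andbT => t0.
rewrite -EFinD lee_fin /gamma_fun -mulrDl ler_wpM2r ?expR_ge0//.
rewrite subrr powRr0 -[N.+1%:R]natr1 !addrK.
have [t1|t1] := leP 1 t.
  by rewrite (le_trans (ler_powR t1 xN))// lerDr.
apply: (@le_trans _ _ 1); last by rewrite lerDl powR_ge0.
by rewrite -(powRr0 t) ger_powR ?t0 ?ltW.
Qed.

(** After the shift to [x + 1] the integrand is at least [expR (- 2)] on the segment from 1 to 2. *)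
Lemma eGamma_gt0 x : 0 < x -> (0 < eGamma x)%E.
Proof.
move=> x0; suff: (0 < eGamma (x + 1))%E.
  by rewrite eGammaDr1// pmule_rgt0.
apply: (@lt_le_trans _ _ (\int[mu]_(t in `[1%R, 2%R]) (expR (- 2))%:E)%E).
  rewrite integral_cst//=.
  rewrite lebesgue_measure_itv/= lte_fin ltr1n/= -EFinD -EFinM lte_fin.
  by rewrite mulr_gt0 ?expR_gt0// subr_gt0 ltr1n.
apply: (@le_trans _ _ (\int[mu]_(t in `[1%R, 2%R]) (gamma_fun (x + 1) t)%:E)%E).
  apply: ge0_le_integral => //.
  - by apply/measurable_EFinP; apply: measurable_gamma_fun; exact: measurable_itv.
  move=> t; rewrite /= in_itv/= => /andP[t1 t2].
  rewrite lee_fin /gamma_fun addrK -[leLHS]mul1r ler_pM ?expR_ge0//.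
    by rewrite -(powRr0 t) ler_powR// ltW.
  by rewrite ler_expR lerN2.
apply: ge0_subset_integral => //.
- by apply/measurable_EFinP; apply: measurable_gamma_fun; exact: measurable_itv.
- by move=> t _; rewrite lee_fin gamma_fun_ge0.
- by move=> t; rewrite /= !in_itv/= andbT => /andP[+ _]; exact: lt_le_trans.
Qed.

Lemma GammaE x : Gamma x = fine (eGamma x). Proof. by []. Qed.

Lemma Gamma_gt0 x : 0 < x -> 0 < Gamma x.
Proof. by move=> x0; rewrite GammaE fine_gt0// eGamma_gt0// eGamma_lty. Qed.

Lemma GammaDr1 x : 0 < x -> Gamma (x + 1) = x * Gamma x.
Proof.
move=> x0; rewrite !GammaE eGammaDr1// fineM// ge0_fin_numE ?eGamma_ge0//.
exact: eGamma_lty.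
Qed.

Lemma Gamma_natDr1 n : Gamma (n%:R + 1 : R) = n`!%:R.
Proof. by rewrite GammaE natr1 eGamma_natS. Qed.

(** Turns the Gamma quotient of the mass function into a finite product. *)
Lemma Gamma_rising x n : 0 < x -> Gamma (x + n%:R) = \prod_(j < n) (x + j%:R) * Gamma x.
Proof.
move=> x0; elim: n => [|n ih]; first by rewrite addr0 big_ord0 mul1r.
have xn0 : 0 < x + n%:R by rewrite ltr_wpDr.
have -> : x + n.+1%:R = (x + n%:R) + 1 by rewrite -addrA natr1.
by rewrite (GammaDr1 xn0) ih big_ord_recr/= mulrA [_ * (x + _)]mulrC.
Qed.

End EulerGamma.

(** * Masses of the extended negative binomial distribution *)

Section NegativeBinomial.
Variable R : realType.
Implicit Types (r s q mu p : R) (y K : nat).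

(** The generalized binomial coefficient [r + y - 1] over [y]. *)
Definition nb_coef r y : R := \prod_(j < y) (r + j%:R) / y`!%:R.

Lemma nb_coef0 r : nb_coef r 0 = 1.
Proof. by rewrite /nb_coef big_ord0 fact0 divr1. Qed.

Lemma nb_coefS r y : y.+1%:R * nb_coef r y.+1 = (r + y%:R) * nb_coef r y.
Proof.
rewrite /nb_coef big_ord_recr/= factS natrM.
have y0 : y.+1%:R != 0 :> R by rewrite pnatr_eq0.
have f0 : y`!%:R != 0 :> R by rewrite pnatr_eq0 -lt0n fact_gt0.
by field; rewrite f0 addrC natr1.
Qed.

Lemma nb_coef_gt0 r y : 0 < r -> 0 < nb_coef r y.
Proof.
move=> r0; rewrite divr_gt0 ?ltr0n ?fact_gt0//.
by apply: prodr_gt0 => j _; rewrite ltr_wpDr.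
Qed.

(** The binomial series of [(1 - s) ^ (- r)], truncated at degree [K]. *)
Definition nb_poly r K : {poly R} := \sum_(y < K.+1) nb_coef r y *: 'X^y.

(** The full series solves [(1 - s) y' = r y]; truncation leaves one term of degree [K], which
    [nb_coefS] moves from [K] to [K + 1]. *)
Lemma nb_poly_deriv r K s :
  (1 - s) * (nb_poly r K)^`().[s] - r * (nb_poly r K).[s] =
  - ((r + K%:R) * nb_coef r K * s ^+ K).
Proof.
elim: K => [|K ih].
  rewrite /nb_poly big_ord_recr big_ord0/= add0r nb_coef0 scale1r derivXn.
  by rewrite !hornerE.
have -> : nb_poly r K.+1 = nb_poly r K + nb_coef r K.+1 *: 'X^(K.+1).
  by rewrite /nb_poly big_ord_recr.
move: ih (nb_coefS r K); move: (nb_coef r K) (nb_coef r K.+1) => b c.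
rewrite derivD derivZ derivXn !hornerE/= hornerMn !hornerE.
rewrite -(mulr_natl (s ^+ K)) exprS -[K.+1%:R]natr1.
set P := _.[s]; set Q := _.[s]; set t := s ^+ K => ih cS.
have -> : (1 - s) * (P + c * ((K%:R + 1) * t)) - r * (Q + c * (s * t)) =
  ((1 - s) * P - r * Q) + ((K%:R + 1) * c * (1 - s) - r * c * s) * t by ring.
rewrite ih -cS; ring.
Qed.

(* The left-hand side is 1 at q = 0 and, by nb_poly_deriv, nonincreasing in q. *)
Lemma nb_partial_sum_le1 r q K : 0 < r -> 0 <= q < 1 ->
  (1 - q) `^ r * \sum_(y < K) nb_coef r y * q ^+ y <= 1.
Proof.
move=> r0 /andP[q0 q1].
case: K => [|K]; first by rewrite big_ord0 mulr0.
have polyE s : \sum_(y < K.+1) nb_coef r y * s ^+ y = (nb_poly r K).[s].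
  by rewrite horner_sum; apply: eq_bigr => y _; rewrite !hornerE.
rewrite polyE.
pose F s := (1 - s) `^ r * (nb_poly r K).[s].
have dF s : s < 1 ->
    is_derive s 1 F (- ((r + K%:R) * nb_coef r K * s ^+ K) * (1 - s) `^ (r - 1)).
  move=> s1.
  have s0 : 0 < 1 - s by rewrite subr_gt0.
  have dp : is_derive s 1 (fun s : R => (1 - s) `^ r) (- (r * (1 - s) `^ (r - 1))).
    have d1 : is_derive s 1 (fun s : R => 1 - s) (-1).
      by apply: is_derive_eq; rewrite add0r mul1r.
    have := @is_derive1_comp R (fun t : R => t `^ r) (fun s => 1 - s) s _ (-1)
      (is_derive1_powR r s0) d1.
    by rewrite mulrN1.
  apply: is_derive_eq.
  (* Splitting one factor [1 - s] off the power exposes the left-hand side of [nb_poly_deriv]. *)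
  rewrite /GRing.scale/= -(mulr_powRB1 (ltW s0) r0) -nb_poly_deriv.
  by ring.
have F0 : F 0 = 1.
  rewrite /F subr0 powR1 mul1r -polyE big_ord_recl/= nb_coef0 expr0 mulr1.
  by rewrite big1 ?addr0// => i _; rewrite exprS mul0r mulr0.
rewrite -[leLHS]/(F q) -F0.
suff : {in `[0, q] &, {homo F : x y /~ x <= y}} by apply; rewrite // in_itv/= ?lexx q0.
apply: ler0_derive1_le_cc.
- by move=> s; rewrite in_itv/= => /andP[_ sq]; have [] := dF s (lt_trans sq q1).
- move=> s; rewrite in_itv/= => /andP[s0 sq]; rewrite derive1E.
  have [_ ->] := dF s (lt_trans sq q1).
  rewrite mulNr oppr_le0 mulr_ge0 ?powR_ge0// mulr_ge0 ?exprn_ge0 ?(ltW s0)//.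
  by rewrite mulr_ge0 ?addr_ge0 ?(ltW r0)// ltW// nb_coef_gt0.
- apply: derivable_within_continuous => s; rewrite in_itv/= => /andP[_ sq].
  by have [] := dF s (le_lt_trans sq q1).
Qed.

Lemma enb_pmf_nb mu p y : 0 < mu -> 0 < p < 1 ->
  enb_pmf mu p y = nb_coef (mu * p / (1 - p)) y * p `^ (mu * p / (1 - p)) * (1 - p) ^+ y.
Proof.
move=> mu0 /andP[p0 p1]; rewrite /enb_pmf gt_eqF// lt_eqF//=.
set r := mu * p / (1 - p).
have r0 : 0 < r by rewrite divr_gt0 ?mulr_gt0// subr_gt0.
rewrite Gamma_natDr1 Gamma_rising// /nb_coef.
have G0 := Gamma_gt0 r0.
have f0 : y`!%:R != 0 :> R by rewrite pnatr_eq0 -lt0n fact_gt0.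
by congr (_ * _ * _); field; rewrite f0 gt_eqF.
Qed.

Lemma enb_pmf_poisson mu y : 0 < mu -> enb_pmf mu 1 y = mu ^+ y / y`!%:R * expR (- mu).
Proof. by move=> mu0; rewrite /enb_pmf gt_eqF// eqxx /poisson_pmf mu0. Qed.

Lemma enb_pmf1E mu y : 0 < mu -> enb_pmf mu 1 y = poisson_pmf mu y.
Proof. by move=> mu0; rewrite /enb_pmf gt_eqF// eqxx. Qed.

Lemma enb_pmf_gt0 mu p y : 0 < mu -> 0 < p <= 1 -> 0 < enb_pmf mu p y.
Proof.
move=> mu0 /andP[p0]; rewrite le_eqVlt => /predU1P[->|p1].
  by rewrite enb_pmf_poisson// mulr_gt0 ?expR_gt0// divr_gt0 ?exprn_gt0// ltr0n fact_gt0.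
rewrite enb_pmf_nb ?p0// mulr_gt0 ?exprn_gt0 ?subr_gt0// mulr_gt0 ?powR_gt0//.
by rewrite nb_coef_gt0// divr_gt0 ?mulr_gt0 ?subr_gt0.
Qed.

Lemma enb_pmf_ge0 mu p y : enb_param mu p -> 0 <= enb_pmf mu p y.
Proof.
move=> [+ p01]; rewrite le_eqVlt => /predU1P[<-|mu0].
  by rewrite /enb_pmf eqxx ler0n.
exact/ltW/enb_pmf_gt0.
Qed.

Lemma expR_partial_sum (x : R) K : 0 <= x -> \sum_(y < K) x ^+ y / y`!%:R <= expR x.
Proof.
move=> x0; rewrite /expR.
have -> : \sum_(y < K) x ^+ y / y`!%:R = series (exp_coeff x) K.
  by rewrite /series/= big_mkord.
apply: nondecreasing_cvgn_le; last exact: is_cvg_series_exp_coeff.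
by apply: nondecreasing_series => i _ _; exact: exp_coeff_ge0.
Qed.

Lemma enb_pmf_sum_le1 mu p K : enb_param mu p -> \sum_(y < K) enb_pmf mu p y <= 1.
Proof.
move=> [+ p01]; rewrite le_eqVlt => /predU1P[<-|mu0].
  rewrite /enb_pmf eqxx; case: K => [|K]; first by rewrite big_ord0.
  by rewrite big_ord_recl/= big1 ?addr0.
move: (p01) => /andP[p0]; rewrite le_eqVlt => /predU1P[->|p1].
  under eq_bigr do rewrite enb_pmf_poisson//.
  rewrite -mulr_suml expRN ler_pdivrMr ?expR_gt0// mul1r.
  exact/expR_partial_sum/ltW.
under eq_bigr do rewrite enb_pmf_nb ?p0//.
set r := mu * p / (1 - p).
have r0 : 0 < r by rewrite divr_gt0 ?mulr_gt0// subr_gt0.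
under eq_bigr do rewrite mulrAC mulrC.
rewrite -mulr_sumr -{1}(subKr 1 p).
by apply: nb_partial_sum_le1 => //; rewrite subr_ge0 ltW//= gtrBl.
Qed.

Lemma enb_pmf_le1 mu p y : enb_param mu p -> enb_pmf mu p y <= 1.
Proof.
move=> H; apply: le_trans (enb_pmf_sum_le1 y.+1 H).
rewrite big_ord_recr/= lerDr; apply: sumr_ge0 => i _; exact: enb_pmf_ge0.
Qed.

(* Makes p a continuous function of three masses, so that pointwise convergence of
   the masses is enough. *)
Lemma enb_pmf_ratio mu p : 0 < mu -> 0 < p <= 1 ->
  1 - p = 2 * enb_pmf mu p 2 / enb_pmf mu p 1 - enb_pmf mu p 1 / enb_pmf mu p 0.
Proof.
move=> mu0 /andP[p0]; rewrite le_eqVlt => /predU1P[->|p1].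
  rewrite !enb_pmf_poisson//= expr0 expr1 !factS fact0.
  have e0 : expR (- mu) != 0 by rewrite gt_eqF ?expR_gt0.
  by field; rewrite e0 gt_eqF.
(* Here [2 f2 / f1 = (r + 1) (1 - p)] and [f1 / f0 = r (1 - p)]; in the Poisson case above both
   ratios are [mu]. *)
rewrite !enb_pmf_nb ?p0//.
set r := mu * p / (1 - p).
have r0 : 0 < r by rewrite divr_gt0 ?mulr_gt0// subr_gt0.
have P0 : p `^ r != 0 by rewrite gt_eqF ?powR_gt0.
have p1' : 1 - p != 0 by rewrite gt_eqF ?subr_gt0.
rewrite /nb_coef !big_ord_recl !big_ord0/= !factS fact0.
rewrite (_ : bump 0 0 = 1%N)//; field.
by rewrite P0 p1' gt_eqF.
Qed.

End NegativeBinomial.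

(** * The mean of a maximum likelihood estimate *)

Section MeanOfMLE.
Variable R : realType.
Implicit Types (mu p : R).

(** Strictness away from 1 is what makes the mean the only possible maximizer. *)
Lemma ln_ltB1 (t : R) : 0 < t -> t != 1 -> ln t < t - 1.
Proof.
move=> t0 t1; rewrite ltrBrDl -[ltRHS]lnK// expR_gt1Dx//.
by rewrite ln_eq0.
Qed.

Lemma ln_leB1 (t : R) : 0 < t -> ln t <= t - 1.
Proof.
move=> t0; have [->|t1] := eqVneq t 1; first by rewrite ln1 subrr.
exact/ltW/ln_ltB1.
Qed.

Lemma enb_loglik_EFin (n : nat) (Y : 'I_n -> nat) mu p : 0 < mu -> 0 < p <= 1 ->
  enb_loglik Y mu p = (\sum_(i < n) ln (enb_pmf mu p (Y i)))%:E.
Proof.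
move=> mu0 p01; rewrite /enb_loglik -sumEFin; apply: eq_bigr => i _.
by rewrite lne_EFin// enb_pmf_gt0.
Qed.

Lemma enb_loglik0 (n : nat) (Y : 'I_n -> nat) p : (forall i, Y i = 0%N) ->
  enb_loglik Y 0 p = 0%E.
Proof.
by move=> Y0; rewrite /enb_loglik big1// => i _; rewrite /enb_pmf eqxx Y0 lne1.
Qed.

Lemma enb_loglik0_Ny (n : nat) (Y : 'I_n -> nat) p i : (0 < Y i)%N ->
  enb_loglik Y 0 p = -oo%E.
Proof.
move=> Yi; rewrite /enb_loglik (bigD1 i)// {1}/enb_pmf eqxx gtn_eqF//.
by rewrite le0_lneNy// addNye.
Qed.

(** The mass at 1 is positive, and the masses at 0 and 1 add up to at most 1. *)
Lemma enb_pmf0_lt1 mu p : 0 < mu -> 0 < p <= 1 -> enb_pmf mu p 0 < 1.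
Proof.
move=> mu0 p01; apply: (@lt_le_trans _ _ (\sum_(y < 2) enb_pmf mu p y)).
  by rewrite !big_ord_recl big_ord0/= addr0 ltrDl enb_pmf_gt0.
by apply: enb_pmf_sum_le1; split => //; exact: ltW.
Qed.

Lemma sum_sample (n : nat) (Y : 'I_n -> nat) : (0 < n)%N ->
  \sum_(i < n) (Y i)%:R = n%:R * sample_mean R Y.
Proof. by move=> n0; rewrite mulVKf// pnatr_eq0 -lt0n. Qed.

Lemma poisson_mle_mean (n : nat) (Y : 'I_n -> nat) mu : (0 < n)%N ->
  0 < sample_mean R Y -> 0 < mu ->
  (enb_loglik Y (sample_mean R Y) 1 <= enb_loglik Y mu 1)%E ->
  mu = sample_mean R Y.
Proof.
move=> n0 m0 mu0; have SE := sum_sample Y n0.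
move: m0 SE; set m := sample_mean R Y => m0 SE.
rewrite !enb_loglik_EFin ?ltr01 ?lexx// lee_fin -subr_ge0 -sumrB.
(* The factorials cancel, so the log-likelihood difference is [n (m ln (mu / m) + m - mu)], which is
   negative unless [mu = m]. *)
have step (i : 'I_n) : ln (enb_pmf mu 1 (Y i)) - ln (enb_pmf m 1 (Y i)) =
    (Y i)%:R * ln (mu / m) + (m - mu).
  rewrite -ln_div ?posrE ?enb_pmf_gt0 ?ltr01 ?lexx// !enb_pmf_poisson//.
  have f0 : (Y i)`!%:R != 0 :> R by rewrite pnatr_eq0 -lt0n fact_gt0.
  have e0 : expR (- m) != 0 by rewrite gt_eqF ?expR_gt0.
  have -> : mu ^+ Y i / (Y i)`!%:R * expR (- mu) / (m ^+ Y i / (Y i)`!%:R * expR (- m)) =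
    (mu / m) ^+ Y i * expR (m - mu).
    rewrite expr_div_n expRD -[expR m]invrK -expRN.
    by field; rewrite e0 f0 expf_neq0// gt_eqF.
  rewrite lnM ?posrE ?exprn_gt0 ?divr_gt0 ?expR_gt0// expRK lnXn ?divr_gt0//.
  by rewrite mulr_natl.
rewrite (eq_bigr _ (fun i _ => step i)) big_split/= -mulr_suml SE.
rewrite sumr_const card_ord -[(m - mu) *+ n]mulr_natl -mulrA -mulrDr.
rewrite pmulr_rge0 ?ltr0n// => H.
apply/eqP; rewrite -[_ == _]negbK; apply/negP => mum.
have t1 : mu / m != 1.
  by apply: contra mum => /eqP t1; rewrite -(divfK (lt0r_neq0 m0) mu) t1 mul1r.
have := ln_ltB1 (divr_gt0 mu0 m0) t1.
rewrite -(ltr_pM2l m0) mulrBr mulr1 mulrCA divff ?gt_eqF// mulr1 => lt.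
lra.
Qed.

Lemma nb_mle_mean (n : nat) (Y : 'I_n -> nat) mu p : (0 < n)%N ->
  0 < sample_mean R Y -> 0 < mu -> 0 < p < 1 ->
  (forall mu' p', enb_param mu' p' ->
    (enb_loglik Y mu' p' <= enb_loglik Y mu p)%E) ->
  mu = sample_mean R Y.
Proof.
move=> n0 m0 mu0 /andP[p0 p1]; have SE := sum_sample Y n0.
move: m0 SE; set m := sample_mean R Y => m0 SE.
have q0 : 0 < 1 - p by rewrite subr_gt0.
pose r := mu * p / (1 - p).
have r0 : 0 < r by rewrite divr_gt0 ?mulr_gt0// subr_gt0.
have rm0 : 0 < r + m by rewrite addr_gt0.
(* The competitor with mean [m] on the same curve: [p'] solves [m p' / (1 - p') = r]. *)
pose p' := r / (r + m).
have p'0 : 0 < p' by rewrite divr_gt0.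
have q'E : 1 - p' = m / (r + m) by rewrite /p'; field; rewrite gt_eqF.
have q'0 : 0 < 1 - p' by rewrite q'E divr_gt0.
have p'1 : p' < 1 by rewrite -subr_gt0.
have r'E : m * p' / (1 - p') = r.
  by rewrite q'E /p'; field; rewrite !gt_eqF.
have p01 : 0 < p <= 1 by rewrite p0 ltW.
have p'01 : 0 < p' <= 1 by rewrite p'0 ltW.
move=> /(_ m p'); move=> /(_ (conj (ltW m0) p'01)).
rewrite !enb_loglik_EFin// lee_fin -subr_ge0 -sumrB.
(* Equal [r] on both sides makes the coefficients cancel. *)
have step (i : 'I_n) : ln (enb_pmf mu p (Y i)) - ln (enb_pmf m p' (Y i)) =
    r * ln (p / p') + (Y i)%:R * ln ((1 - p) / (1 - p')).
  rewrite -ln_div ?posrE ?enb_pmf_gt0// !enb_pmf_nb ?p'0 ?p0//.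
  rewrite r'E -/r.
  have c0 := nb_coef_gt0 (Y i) r0.
  have -> : nb_coef r (Y i) * p `^ r * (1 - p) ^+ Y i /
      (nb_coef r (Y i) * p' `^ r * (1 - p') ^+ Y i) =
      (p / p') `^ r * ((1 - p) / (1 - p')) ^+ Y i.
    rewrite expr_div_n powRM ?invr_ge0 ?(ltW p0) ?(ltW p'0)//.
    rewrite -(powR_inv1 (ltW p'0)) -powRrM mulN1r powRN.
    by field; rewrite !gt_eqF ?exprn_gt0 ?powR_gt0.
  have qq0 := divr_gt0 q0 q'0; have pp0 := divr_gt0 p0 p'0.
  rewrite lnM ?posrE ?exprn_gt0 ?powR_gt0// ln_powR lnXn//.
  by rewrite mulr_natl.
rewrite (eq_bigr _ (fun i _ => step i)) big_split/= sumr_const.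
rewrite -mulr_suml SE card_ord -[(r * _) *+ n]mulr_natl -mulrA -mulrDr.
rewrite pmulr_rge0 ?ltr0n// => H.
(* If [p = p'], the two equations for [r] give [mu = m]. Otherwise the bounds [ln t <= t - 1],
   weighted by [r] and [m], add up to 0 with one of them strict, against [H]. *)
have [pp'|pp'] := eqVneq p p'.
  have rp : r * (1 - p) = mu * p by rewrite /r divfK ?gt_eqF.
  have : p * (r + m) = r by rewrite pp' /p' divfK ?gt_eqF.
  move=> prm; apply: (mulIf (lt0r_neq0 p0)); lra.
have t1 : p / p' != 1.
  by apply: contra pp' => /eqP t1; rewrite -(divfK (lt0r_neq0 p'0) p) t1 mul1r.
have := ln_ltB1 (divr_gt0 p0 p'0) t1.
have := ln_leB1 (divr_gt0 q0 q'0).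
rewrite -(ler_pM2l m0) -(ltr_pM2l r0).
have -> : m * ((1 - p) / (1 - p') - 1) = (r + m) * (1 - p) - m.
  by rewrite q'E; field; rewrite !gt_eqF.
have -> : r * (p / p' - 1) = (r + m) * p - r.
  by rewrite /p'; field; rewrite !gt_eqF.
move=> h1 h2; lra.
Qed.

Lemma enb_mle_mean (n : nat) (Y : 'I_n -> nat) mu p : (0 < n)%N ->
  is_enb_mle Y mu p -> mu = sample_mean R Y.
Proof.
move=> n0 [[mu_ge0 /andP[p0 p1]] mle].
have m_ge0 : 0 <= sample_mean R Y by rewrite mulr_ge0 ?sumr_ge0.
move: m_ge0; rewrite le_eqVlt => /predU1P[m0|m0].
  have Y0 i : Y i = 0%N.
    have /eqP := sum_sample Y n0; rewrite -m0 mulr0 psumr_eq0// => /allP/(_ i).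
    by rewrite mem_index_enum pnatr_eq0 => /(_ isT)/eqP.
  (* An all-zero sample has log-likelihood 0 at [mu = 0] and a negative one at any [mu > 0]. *)
  rewrite -m0; apply/esym/eqP; move: mu_ge0; rewrite le_eqVlt => /orP[//|mu0].
  have := mle 0 1 (conj (lexx _) (introT andP (conj ltr01 (lexx _)))).
  rewrite enb_loglik0// enb_loglik_EFin ?p0// lee_fin leNgt => /negP[].
  under eq_bigr do rewrite Y0.
  rewrite sumr_const card_ord -mulr_natl pmulr_rlt0 ?ltr0n// ln_lt0//.
  by rewrite enb_pmf_gt0 ?enb_pmf0_lt1 ?p0.
have Pm1 : enb_param (sample_mean R Y) 1 by split; [exact: ltW|rewrite ltr01 lexx].
(* A positive observation has mass 0 under [mu = 0], whereas the Poisson law at the sample mean has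
   finite log-likelihood. *)
have mu0 : 0 < mu.
  rewrite lt_neqAle mu_ge0 andbT; apply/eqP => mu0.
  have [i Yi] : exists i, (0 < Y i)%N.
    apply/existsP; rewrite -[X in is_true X]negbK negb_exists; apply/negP => /forallP Y0.
    have := sum_sample Y n0; rewrite big1; last first.
      by move=> i _; have := Y0 i; rewrite -eqn0Ngt => /eqP ->.
    by move/esym/eqP; rewrite mulf_eq0 pnatr_eq0 gtn_eqF//= gt_eqF.
  have := mle _ _ Pm1; rewrite -mu0 (enb_loglik0_Ny _ Yi).
  by rewrite enb_loglik_EFin// ltr01 lexx.
move: p1; rewrite le_eqVlt => /predU1P[p1|p1].
  by apply: poisson_mle_mean => //; rewrite -{2}p1; exact: mle.
by apply: nb_mle_mean mle; rewrite ?p0.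
Qed.

End MeanOfMLE.

(** * A strong law of large numbers *)

Section StrongLaw.

(** By monotonicity [a n] lies between its values at the neighbouring squares, whose ratio tends to
    1. *)
Lemma cvg_avg_squares (R : realType) (a : nat -> R) (m : R) :
  nondecreasing_seq a -> (forall n, 0 <= a n) ->
  a (k.+1 ^ 2)%N / (k.+1 ^ 2)%:R @[k --> \oo] --> m ->
  a n / n%:R @[n --> \oo] --> m.
Proof.
move=> nda a0 am.
pose isqrt (n : nat) := Num.truncn (Num.sqrt n%:R : R).
have isqrt_le n : (isqrt n ^ 2 <= n)%N.
  rewrite -(ler_nat R) natrX -[leRHS]sqr_sqrtr// ler_sqr ?nnegrE//.
  by have /andP[] := truncn_itv (sqrtr_ge0 (n%:R : R)).
have isqrt_gt n : (n <= (isqrt n).+1 ^ 2)%N.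
  rewrite -(ler_nat R) natrX -[leLHS]sqr_sqrtr// ler_sqr ?nnegrE//.
  by have /andP[_ /ltW] := truncn_itv (sqrtr_ge0 (n%:R : R)).
have isqrt_oo : isqrt n @[n --> \oo] --> \oo.
  apply/cvgnyPge => A; near=> n.
  rewrite -(@natrK R A); apply: le_truncn.
  rewrite -[leLHS](ger0_norm (ler0n R A)) -sqrtr_sqr ler_sqrt// -natrX ler_nat.
  by near: n; exact: nbhs_infty_ge.
have hoo : (isqrt n).+1%:R^-1 @[n --> \oo] --> (0 : R).
  exact: (cvg_comp _ _ isqrt_oo (@cvg_harmonic R)).
pose s k := a (k ^ 2)%N / (k ^ 2)%:R.
have sS : s k @[k --> \oo] --> m by rewrite -cvg_shiftS.
(* As [1 - 1 / (k + 1) = k / (k + 1)], for [k >= 1] these are [a (k ^ 2) / (k + 1) ^ 2] and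
   [a ((k + 1) ^ 2) / k ^ 2]. *)
pose lo k := s k * (1 - k.+1%:R^-1) ^+ 2.
pose hi k := s k.+1 / (1 - k.+1%:R^-1) ^+ 2.
have onem : (1 - k.+1%:R^-1) ^+ 2 @[k --> \oo] --> (1 : R).
  rewrite -[X in _ --> X](expr1n _ 2) -[X in X ^+ 2](subr0 1).
  apply: (@cvgM _ _ _ _ (fun k => 1 - k.+1%:R^-1) (fun k => 1 - k.+1%:R^-1));
    by apply: cvgB; [exact: cvg_cst|exact: cvg_harmonic].
have lom : lo k @[k --> \oo] --> m.
  by rewrite -[X in _ --> X]mulr1; apply: cvgM.
have him : hi k @[k --> \oo] --> m.
  rewrite -[X in _ --> X]mulr1 -[1](invr1 R); apply: cvgM.
    by rewrite cvg_shiftS.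
  by apply: cvgV; rewrite ?oner_neq0.
apply: (@squeeze_cvgr _ _ _ _ (lo \o isqrt) (hi \o isqrt)).
- near=> n.
  have n0 : (0 < n)%N by near: n; exact: nbhs_infty_gt.
  have k1 : (1 <= isqrt n)%N by near: n; move/cvgnyPge : isqrt_oo; exact.
  set k := isqrt n in k1 *.
  have k0 : k%:R != 0 :> R by rewrite pnatr_eq0 -lt0n.
  have kE : 1 - k.+1%:R^-1 = k%:R / k.+1%:R :> R.
    by rewrite -natr1; field; rewrite natr1 pnatr_eq0.
  apply/andP; split.
    rewrite /= -/k /lo /s kE natrX expr_div_n mulrA divfK ?sqrf_eq0//.
    rewrite ler_pM ?invr_ge0//; first exact: (nda _ _ (isqrt_le n)).
    rewrite lef_pV2 ?posrE ?exprn_gt0 ?ltr0n// -natrX ler_nat; exact: isqrt_gt.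
  rewrite /= -/k /hi /s kE natrX expr_div_n invf_div mulrA divfK ?sqrf_eq0 ?pnatr_eq0//.
  rewrite ler_pM ?invr_ge0//; first exact: (nda _ _ (isqrt_gt n)).
  rewrite lef_pV2 ?posrE ?exprn_gt0 ?ltr0n// -natrX ler_nat; exact: isqrt_le.
- exact: (cvg_comp _ _ isqrt_oo lom).
- exact: (cvg_comp _ _ isqrt_oo him).
Unshelve. all: by end_near. Qed.

Context d (T : measurableType d) (R : realType) (P : probability T R).

(** The sum of the series has finite expectation, hence is almost surely finite, and then its terms
    tend to 0. *)
Lemma ae_cvg0_summable (f : nat -> T -> R) :
  (forall k, measurable_fun setT (f k)) -> (forall k w, 0 <= f k w) ->
  (\sum_(0 <= k <oo) \int[P]_w (f k w)%:E < +oo)%E ->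
  {ae P, forall w, f k w @[k --> \oo] --> (0 : R)}.
Proof.
move=> mf f0 foo.
have mfE k : measurable_fun setT (fun w => (f k w)%:E) by exact/measurable_EFinP.
have fE0 k w : (0 <= (f k w)%:E)%E by rewrite lee_fin.
have : P.-integrable setT (fun w => \sum_(0 <= k <oo) (f k w)%:E)%E.
  apply/integrableP; split.
    by apply: ge0_emeasurable_sum => // k w _ _.
  under eq_integral do rewrite gee0_abs ?nneseries_ge0//.
  by rewrite integral_nneseries.
move=> /(integrable_ae measurableT); apply: filterS => w /(_ I) fin.
apply: cvg_series_cvg_0; apply: nondecreasing_is_cvgn.
  by apply: nondecreasing_series => i _ _; exact: f0.
exists (fine (\sum_(0 <= k <oo) (f k w)%:E)%E) => _ [n _ <-].
rewrite -lee_fin fineK// /series/= -sumEFin.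
by apply: nneseries_lim_ge => k _ _; exact: fE0.
Qed.

(** Telescoping: [1 / (n + 2) ^ 2 <= 1 / (n + 1) - 1 / (n + 2)]. At [n = 0] the inverse is 0 by
    convention. *)
Lemma sum_inv_sqr_le n : \sum_(0 <= k < n) (k.+1 ^ 2)%:R^-1 <= 2 - n%:R^-1 :> R.
Proof.
case: n => [|n]; first by rewrite big_nil invr0 subr0.
elim: n => [|n ih]; first by rewrite big_nat1 exp1n invr1; lra.
rewrite big_nat_recr//=; apply: (le_trans (lerD ih (lexx _))).
rewrite -addrA lerD2l addrC -lerBrDr opprK natrX.
have n0 : 0 < n.+1%:R :> R by [].
have -> : - n.+2%:R^-1 + n.+1%:R^-1 = (n.+2%:R * n.+1%:R)^-1 :> R.
  by rewrite -[n.+2%:R]natr1; field; rewrite gt_eqF//= natr1 pnatr_eq0.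
by rewrite lef_pV2 ?posrE ?exprn_gt0 ?mulr_gt0// expr2 ler_pM2l// ler_nat.
Qed.

Variables (X : nat -> T -> R) (m M : R).
Hypothesis mX : forall i, measurable_fun setT (X i).
Hypothesis X0 : forall i w, 0 <= X i w.
Hypothesis EX : forall i, (\int[P]_w (X i w)%:E = m%:E)%E.
Hypothesis EX2 : forall i, (\int[P]_w (X i w ^+ 2)%:E <= M%:E)%E.
(** The form in which independence enters: pairs are uncorrelated. *)
Hypothesis EXX : forall i j, i != j -> (\int[P]_w (X i w * X j w)%:E = (m ^+ 2)%:E)%E.

Let S n w : R := \sum_(i < n) X i w.

Let mS n : measurable_fun setT (S n).
Proof. by apply: measurable_sum => i; exact: mX. Qed.

Let S0 n w : 0 <= S n w.
Proof. exact: sumr_ge0. Qed.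

Let m0 : 0 <= m.
Proof. by rewrite -lee_fin -(EX 0); apply: integral_ge0 => w _; rewrite lee_fin. Qed.

Let M0 : 0 <= M.
Proof.
rewrite -lee_fin; apply: le_trans (EX2 0); apply: integral_ge0 => w _.
by rewrite lee_fin sqr_ge0.
Qed.

Let ES n : (\int[P]_w (S n w)%:E = (n%:R * m)%:E)%E.
Proof.
under eq_integral do rewrite /S -sumEFin.
rewrite ge0_integral_sum//; last 2 first.
- by move=> i; exact/measurable_EFinP.
- by move=> i w _; rewrite lee_fin.
by under eq_bigr do rewrite EX; rewrite sumEFin sumr_const card_ord mulr_natl.
Qed.

Let ES2 n : (\int[P]_w (S n w ^+ 2)%:E <= (n%:R * M + (n%:R * m) ^+ 2)%:E)%E.
Proof.
have -> : (\int[P]_w (S n w ^+ 2)%:E =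
    \sum_(i < n) \sum_(j < n) \int[P]_w (X i w * X j w)%:E)%E.
  have XX0 i j w : (0 <= (X i w * X j w)%:E)%E by rewrite lee_fin mulr_ge0.
  have mXX i j : measurable_fun setT (fun w => (X i w * X j w)%:E).
    by apply/measurable_EFinP; exact: measurable_funM.
  under eq_bigr do rewrite -ge0_integral_sum//.
  rewrite -ge0_integral_sum//; last 2 first.
  - by move=> i; apply: emeasurable_sum.
  - by move=> i w _; apply: sume_ge0.
  apply: eq_integral => w _; rewrite expr2 /S mulr_suml -sumEFin.
  by apply: eq_bigr => i _; rewrite mulr_sumr -sumEFin.
(* The bound is spread over all pairs: [m ^ 2] for each, with a further [M] on the diagonal. *)
have -> : n%:R * M + (n%:R * m) ^+ 2 =
    \sum_(i < n) \sum_(j < n) ((i == j)%:R * M + m ^+ 2).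
  under eq_bigr do rewrite big_split/= -mulr_suml sumr_const card_ord.
  rewrite big_split/= sumr_const card_ord.
  under eq_bigr => i _.
    rewrite (bigD1 i)//= eqxx big1 ?addr0 ?mul1r; last first.
      by move=> j ji; rewrite eq_sym (negbTE ji).
    over.
  by rewrite sumr_const card_ord -mulrnA -(mulr_natl M) -(mulr_natl (m ^+ 2))
    natrM exprMn expr2.
rewrite -sumEFin; apply: lee_sum => i _; rewrite -sumEFin; apply: lee_sum => j _.
have [->|ij] := eqVneq i j.
  rewrite mul1r; apply: (le_trans (EX2 j)); by rewrite lee_fin lerDl sqr_ge0.
by rewrite mul0r add0r EXX.
Qed.

Let ES_var n : (\int[P]_w ((S n w - n%:R * m) ^+ 2)%:E <= (n%:R * M)%:E)%E.
Proof.
set c := n%:R * m.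
have c0 : 0 <= c by rewrite mulr_ge0.
have mD : measurable_fun setT (fun w => ((S n w - c) ^+ 2)%:E).
  by apply/measurable_EFinP; apply: measurable_funX; apply: measurable_funB.
have mC : measurable_fun setT (fun w => (2 * c)%:E * (S n w)%:E)%E.
  by apply: measurable_funeM; exact/measurable_EFinP.
(* The cross term of the square stands on the left, so that every integrand is nonnegative and
   additivity applies. *)
have : (\int[P]_w ((S n w - c) ^+ 2)%:E + (2 * c)%:E * \int[P]_w (S n w)%:E =
    \int[P]_w (S n w ^+ 2)%:E + (c ^+ 2)%:E)%E.
  rewrite -ge0_integralZl//; last 3 first.
  - exact/measurable_EFinP.
  - by move=> w _; rewrite lee_fin.
  - by rewrite lee_fin mulr_ge0.
  rewrite -ge0_integralD//; last 2 first.
  - by move=> w _; rewrite lee_fin sqr_ge0.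
  - by move=> w _; rewrite -EFinM lee_fin !mulr_ge0.
  have -> : (c ^+ 2)%:E = (\int[P]_w (c ^+ 2)%:E)%E.
    by rewrite integral_cst//= probability_setT mule1.
  rewrite -ge0_integralD//; last 3 first.
  - by move=> w _; rewrite lee_fin sqr_ge0.
  - by apply/measurable_EFinP; apply: measurable_funX.
  - by move=> w _; rewrite lee_fin sqr_ge0.
  by apply: eq_integral => w _; rewrite -EFinM -!EFinD; congr (_%:E); ring.
rewrite ES -/c => H.
rewrite -(@leeD2rE _ (2 * c * c)%:E)// -EFinM in H *.
rewrite H -EFinD; apply: (le_trans (leeD (ES2 n) (lexx _))).
by rewrite -/c -EFinD lee_fin; rewrite le_eqVlt; apply/orP; left; apply/eqP; ring.
Qed.

(* Along the squares the mean square deviations are summable; since the X i are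
   nonnegative, monotonicity of the sums fills the gaps. *)
Theorem strong_law : {ae P, forall w, S n w / n%:R @[n --> \oo] --> m}.
Proof.
pose D k w := (S (k.+1 ^ 2)%N w / (k.+1 ^ 2)%:R - m) ^+ 2.
have mD k : measurable_fun setT (D k).
  apply: measurable_funX; apply: measurable_funB => //.
  by apply: measurable_funM.
have : {ae P, forall w, D k w @[k --> \oo] --> (0 : R)}.
  apply: ae_cvg0_summable => //; first by move=> k w; exact: sqr_ge0.
  apply: (@le_lt_trans _ _ (2 * M)%:E); last exact: ltry.
  apply: lime_le.
    by apply: is_cvg_nneseries => k _ _; apply: integral_ge0 => w _;
      rewrite lee_fin sqr_ge0.
  near=> n.
  (* With [N = (k + 1) ^ 2], the variance bound [N M] divided by [N ^ 2] leaves [M / N]. *)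
  apply: (@le_trans _ _ (\sum_(0 <= k < n) ((k.+1 ^ 2)%:R^-1 * M)%:E)%E).
    apply: lee_sum => k _; set N := (k.+1 ^ 2)%N.
    have N0 : N%:R != 0 :> R by rewrite pnatr_eq0 expn_eq0.
    have DE w : (D k w)%:E = ((N%:R^-1 ^+ 2)%:E * ((S N w - N%:R * m) ^+ 2)%:E)%E.
      by rewrite -EFinM /D -/N; congr (_%:E); field.
    under eq_integral do rewrite DE.
    rewrite ge0_integralZl//; last 2 first.
    - by apply/measurable_EFinP; apply: measurable_funX; apply: measurable_funB.
    - by move=> w _; rewrite lee_fin sqr_ge0.
    apply: (@le_trans _ _ ((N%:R^-1 ^+ 2)%:E * (N%:R * M)%:E)%E).
      by apply: lee_wpmul2l => //; rewrite lee_fin sqr_ge0.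
    by rewrite -EFinM lee_fin le_eqVlt; apply/orP; left; apply/eqP; field.
  rewrite sumEFin lee_fin -mulr_suml ler_wpM2r//.
  by apply: (le_trans (sum_inv_sqr_le n)); rewrite gerBl invr_ge0.
apply: filterS => w Dw; apply: cvg_avg_squares => //.
  apply/nondecreasing_seqP => n; by rewrite /S big_ord_recr/= lerDl.
apply/subr_cvg0/norm_cvg0P.
rewrite -[X in _ --> X](sqrtr0 R).
under eq_cvg do rewrite -sqrtr_sqr.
by apply: cvg_comp; [exact: Dw|exact: sqrt_continuous].
Unshelve. all: by end_near. Qed.

End StrongLaw.

(** * Poisson samples *)

Section PoissonTail.
Variables (R : realType) (lambda : R).
Hypothesis lambda0 : 0 < lambda.
Let g := poisson_pmf lambda.

(** The weights [expR k] turn [lambda] into [expR 1 * lambda] in the exponential series; the factor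
    [expR (- lambda)] is bounded by 1. *)
Lemma poisson_exp_moment (f : nat -> R) (C : R) :
  (forall k, 0 <= f k <= C * expR k%:R) ->
  (\sum_(0 <= k <oo) (f k * g k)%:E <= (C * expR (expR 1 * lambda))%:E)%E.
Proof.
move=> fC; have C0 : 0 <= C.
  by have /andP[f0 /(le_trans f0)] := fC 0%N; rewrite expR0 mulr1.
apply: lime_le.
  apply: is_cvg_nneseries => k _ _; rewrite lee_fin mulr_ge0 ?poisson_pmf_ge0//.
  by have /andP[] := fC k.
near=> n; rewrite sumEFin lee_fin.
apply: (@le_trans _ _ (C * \sum_(k < n) (expR 1 * lambda) ^+ k / k`!%:R)).
  rewrite big_mkord mulr_sumr; apply: ler_sum => k _.
  have /andP[f0 fk] := fC k.
  apply: (le_trans (ler_wpM2r (poisson_pmf_ge0 _ _) fk)).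
  rewrite -!mulrA ler_wpM2l// /g /poisson_pmf lambda0 exprMn -expRM_natr mul1r.
  rewrite -!mulrA ler_wpM2l ?expR_ge0// ler_wpM2l ?exprn_ge0 ?(ltW lambda0)//.
  by rewrite ger_pMr ?invr_gt0 ?ltr0n ?fact_gt0// expR_le1 oppr_le0 ltW.
by rewrite ler_wpM2l// expR_partial_sum// mulr_ge0 ?expR_ge0// ltW.
Unshelve. all: by end_near. Qed.

Lemma poisson_pmf_gt0 k : 0 < g k.
Proof.
rewrite /g /poisson_pmf lambda0 mulr_gt0 ?expR_gt0//.
by rewrite divr_gt0 ?exprn_gt0// ltr0n fact_gt0.
Qed.

Lemma poisson_pmf_le1 k : g k <= 1.
Proof.
rewrite /g -(enb_pmf1E k lambda0); apply: enb_pmf_le1; split; first exact: ltW.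
by rewrite ltr01 lexx.
Qed.

Lemma ln_fact_le k : ln (k`!%:R : R) <= k%:R ^+ 2.
Proof.
elim: k => [|k ih]; first by rewrite fact0 ln1 sqr_ge0.
rewrite factS natrM lnM ?posrE ?ltr0n ?fact_gt0//.
apply: (@le_trans _ _ (k%:R + k%:R ^+ 2)).
  by rewrite lerD// -natr1 addrC le_ln1Dx// (lt_le_trans (ltrN10 R)).
by rewrite -natr1 sqrrD expr1n mulr1 mulr2n; have := ler0n R k; lra.
Qed.

(** Here [- ln (g k) = ln k! - k ln lambda + lambda]; quadratic growth makes its first two moments
    finite. *)
Lemma oppr_ln_poisson_pmf_le k :
  0 <= - ln (g k) <= (1 + `|ln lambda| + lambda) * k.+1%:R ^+ 2.
Proof.
rewrite oppr_ge0 ln_le0 ?poisson_pmf_le1//=.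
have f0 : 0 < k`!%:R :> R by rewrite ltr0n fact_gt0.
rewrite /g /poisson_pmf lambda0 lnM ?posrE ?expR_gt0 ?divr_gt0 ?exprn_gt0//.
rewrite ln_div ?posrE ?exprn_gt0// expRK lnXn//.
rewrite -[ln lambda *+ k]mulr_natl.
have := ln_fact_le k; have := ler_norm (- ln lambda); rewrite normrN.
have := ler0n R k; rewrite -natr1; set x := k%:R; set a := `|_|.
set F := ln k`!%:R; set L := ln lambda.
move=> x0 al xF.
have a0 : 0 <= a by exact: normr_ge0.
have : x * - L <= x * a by rewrite ler_wpM2l.
rewrite mulrN => h.
have : x ^+ 2 <= (x + 1) ^+ 2 by nra.
have : x * a <= a * (x + 1) ^+ 2 by nra.
have : lambda <= lambda * (x + 1) ^+ 2 by rewrite ler_peMr ?(ltW lambda0)//; nra.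
rewrite !mulrDl mul1r; lra.
Qed.

(** Dominates [ln (f / g)] from [K] on, because a fitted mass [f] is at most 1. *)
Definition poisson_tail_nll K k : R := (K <= k)%:R * - ln (g k).

Lemma poisson_tail_nll_ge0 K k : 0 <= poisson_tail_nll K k.
Proof. by rewrite mulr_ge0//; have /andP[] := oppr_ln_poisson_pmf_le k. Qed.

Let C := 1 + `|ln lambda| + lambda.

Let nll_le K k : poisson_tail_nll K k <= C * k.+1%:R ^+ 2.
Proof.
have /andP[h0 h1] := oppr_ln_poisson_pmf_le k.
rewrite /poisson_tail_nll; case: leqP => _; first by rewrite mul1r.
rewrite mul0r; exact: le_trans h1.
Qed.

Let powS_le_exp n k : k.+1%:R ^+ n.+1 <= n.+1`!%:R * expR 1 * expR k%:R :> R.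
Proof.
rewrite -mulrA -expRD addrC natr1 -ler_pdivrMl ?ltr0n ?fact_gt0// mulrC.
by apply: le_trans (expR_ge1Dxn n (ler0n R k.+1)); rewrite lerDr.
Qed.

Let C0 : 0 <= C.
Proof. by rewrite !addr_ge0// ltW. Qed.

Let nll_exp K k : 0 <= poisson_tail_nll K k <= C * (2`!%:R * expR 1) * expR k%:R.
Proof.
rewrite poisson_tail_nll_ge0/=; apply: (le_trans (nll_le K k)).
by rewrite -mulrA ler_wpM2l// (powS_le_exp 1).
Qed.

Lemma poisson_tail_nll2_le_exp K k :
  0 <= poisson_tail_nll K k ^+ 2 <= C ^+ 2 * (4`!%:R * expR 1) * expR k%:R.
Proof.
rewrite sqr_ge0/=; apply: (@le_trans _ _ ((C * k.+1%:R ^+ 2) ^+ 2)).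
  by rewrite ler_sqr ?nnegrE ?poisson_tail_nll_ge0 ?mulr_ge0 ?exprn_ge0.
by rewrite exprMn -exprM -mulrA ler_wpM2l ?sqr_ge0// (powS_le_exp 3).
Qed.

(** The tail from [K] of the Shannon entropy of the Poisson law; [fine] loses nothing, the series
    being finite. *)
Definition poisson_tail_entropy K : R :=
  fine (\sum_(0 <= k <oo) (poisson_tail_nll K k * g k)%:E)%E.

Lemma poisson_tail_entropyE K :
  (\sum_(0 <= k <oo) (poisson_tail_nll K k * g k)%:E = (poisson_tail_entropy K)%:E)%E.
Proof.
rewrite fineK// ge0_fin_numE; last first.
  by apply: nneseries_ge0 => k _ _; rewrite lee_fin mulr_ge0//
    ?poisson_tail_nll_ge0 ?poisson_pmf_ge0.
by apply: le_lt_trans (poisson_exp_moment (nll_exp K)) _; rewrite ltry.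
Qed.

Lemma poisson_tail_entropy_cvg0 : poisson_tail_entropy K @[K --> \oo] --> 0.
Proof.
pose u k := (- ln (g k) * g k)%:E.
have u0 k : (0 <= u k)%E.
  rewrite lee_fin mulr_ge0 ?poisson_pmf_ge0//.
  by have /andP[] := oppr_ln_poisson_pmf_le k.
have uoo : (\sum_(0 <= k <oo) u k < +oo)%E.
  have := poisson_tail_entropyE 0; under eq_eseriesr do rewrite /poisson_tail_nll/= mul1r.
  by rewrite /u => ->; rewrite ltry.
have tailE K : (\sum_(K <= k <oo) u k = (poisson_tail_entropy K)%:E)%E.
  rewrite -poisson_tail_entropyE.
  rewrite (nneseries_split 0 K)//; last first.
    by move=> k _; rewrite lee_fin mulr_ge0 ?poisson_tail_nll_ge0 ?poisson_pmf_ge0.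
  rewrite add0n big1_seq ?add0e; last first.
    move=> k; rewrite mem_index_iota/= => kK.
    by rewrite /poisson_tail_nll leqNgt kK !mul0r.
  apply/congr_lim/funext => n; apply: eq_big_nat => k /andP[Kk _].
  by rewrite /poisson_tail_nll Kk mul1r.
have := nneseries_tail_cvg uoo (fun k _ => u0 k).
by under eq_cvg do rewrite tailE; move/fine_cvgP => [].
Qed.

End PoissonTail.

(** * Expectations and averages along an i.i.d. Poisson sample *)

Section PoissonSample.
Context d (T : measurableType d) (R : realType) (P : probability T R).

Lemma measurable_comp_nat (Z : {RV P >-> nat}) (f : nat -> R) :
  measurable_fun setT (fun w => f (Z w)).
Proof. by apply: measurableT_comp. Qed.

(** Splits [A] by the values of [Z]; a general [A] allows conditioning on another observation. *)
Lemma integral_comp_nat (Z : {RV P >-> nat}) (A : set T) (f : nat -> R) :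
  measurable A -> (forall k, 0 <= f k) ->
  (\int[P]_(w in A) (f (Z w))%:E =
   \sum_(0 <= k <oo) (f k)%:E * P (A `&` Z @^-1` [set k]))%E.
Proof.
move=> mA f0.
have mZ k : measurable (Z @^-1` [set k]).
  by rewrite -[X in measurable X]setTI; exact: measurable_funP.
have AE : A = \bigcup_k (A `&` Z @^-1` [set k]).
  apply/seteqP; split => [w Aw|w [k _ []]//]; by exists (Z w).
rewrite {1}AE ge0_integral_bigcup//; last 4 first.
- by move=> k; exact: measurableI.
- by apply/measurable_EFinP; apply: measurable_funTS; exact: measurable_comp_nat.
- by move=> w _; rewrite lee_fin.
- by move=> i j _ _ [w [[_ /= <-] [_ /= <-]]].
apply: eq_eseriesr => k _.
rewrite -integral_cst; last exact: measurableI.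
by apply: eq_integral => w /set_mem[_ /= ->].
Qed.

Variables (lambda : R) (Y : nat -> {RV P >-> nat}).
Hypothesis lambda0 : 0 < lambda.
Hypothesis iidY : iid_poisson lambda Y.
Let g := poisson_pmf lambda.

Let mY i k : measurable (Y i @^-1` [set k]).
Proof. by rewrite -[X in measurable X]setTI; exact: measurable_funP. Qed.

Let PY i k : P (Y i @^-1` [set k]) = (g k)%:E.
Proof. by rewrite -(iidY.2 i k). Qed.

Let PYY i j k l : i != j ->
  P (Y i @^-1` [set k] `&` Y j @^-1` [set l]) = ((g k)%:E * (g l)%:E)%E.
Proof.
(* Independence for a two-element index set, with the event chosen by the index. *)
move=> ij; have := iidY.1 [fset i; j]%fset
  (fun a => if a == i then [set k] else [set l]) (fun _ _ => I).
rewrite big_fsetU1 ?inE//= big_seq_fset1 eqxx eq_sym (negbTE ij) !PY => <-.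
congr (P _); apply/seteqP; split => [w [wi wj] a /=|w wij].
  by rewrite !inE => /orP[]/eqP ->; rewrite ?eqxx// eq_sym (negbTE ij).
split.
  by have := wij i; rewrite /= !inE !eqxx/=; exact.
by have := wij j; rewrite /= !inE eqxx orbT eq_sym (negbTE ij); exact.
Qed.

Lemma expectation_poisson_comp (f : nat -> R) i : (forall k, 0 <= f k) ->
  (\int[P]_w (f (Y i w))%:E = \sum_(0 <= k <oo) (f k * g k)%:E)%E.
Proof.
move=> f0; rewrite integral_comp_nat//.
by apply: eq_eseriesr => k _; rewrite setTI PY.
Qed.

(** On the event that [Y i] equals [k] the first factor is the constant [f k], and [PYY] factors the
    remaining probabilities. *)
Lemma expectation_poisson_compM (f : nat -> R) (m : R) i j : i != j ->
  (forall k, 0 <= f k) -> (\sum_(0 <= k <oo) (f k * g k)%:E = m%:E)%E ->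
  (\int[P]_w (f (Y i w) * f (Y j w))%:E = (m ^+ 2)%:E)%E.
Proof.
move=> ij f0 fm.
have YE : setT = \bigcup_k (Y i @^-1` [set k]).
  by apply/seteqP; split => // w _; exists (Y i w).
have g0 k : 0 <= g k := poisson_pmf_ge0 _ _.
rewrite {1}YE ge0_integral_bigcup//; last 3 first.
- apply/measurable_EFinP; apply: measurable_funTS.
  by apply: measurable_funM; exact: measurable_comp_nat.
- by move=> w _; rewrite lee_fin mulr_ge0.
- by move=> a b _ _ [w [/= <- /= <-]].
rewrite expr2 EFinM -{2}fm -nneseriesZl; last by move=> k _; rewrite lee_fin mulr_ge0.
apply: eq_eseriesr => k _.
transitivity (\int[P]_(w in Y i @^-1` [set k]) ((f k)%:E * (f (Y j w))%:E))%E.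
  by apply: eq_integral => w /set_mem/= ->.
rewrite ge0_integralZl//; last 3 first.
- by apply/measurable_EFinP; apply: measurable_funTS; exact: measurable_comp_nat.
- by move=> w _; rewrite lee_fin.
- by rewrite lee_fin.
rewrite integral_comp_nat//.
under eq_eseriesr do rewrite PYY// muleCA -[X in (_ * X)%E]EFinM.
rewrite nneseriesZl; last by move=> l _; rewrite lee_fin mulr_ge0.
by rewrite fm -!EFinM; congr (_%:E); ring.
Qed.

Lemma poisson_strong_law (f : nat -> R) (m M : R) : (forall k, 0 <= f k) ->
  (\sum_(0 <= k <oo) (f k * g k)%:E = m%:E)%E ->
  (\sum_(0 <= k <oo) (f k ^+ 2 * g k)%:E <= M%:E)%E ->
  {ae P, forall w, (\sum_(i < n) f (Y i w)) / n%:R @[n --> \oo] --> m}.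
Proof.
move=> f0 fm fM; apply: (@strong_law _ _ _ P (fun i w => f (Y i w)) m M) => //.
- by move=> i; exact: measurable_comp_nat.
- by move=> i; rewrite expectation_poisson_comp.
- move=> i; rewrite (expectation_poisson_comp (f := fun k => f k ^+ 2))// => k.
  exact: sqr_ge0.
- by move=> i j ij; exact: expectation_poisson_compM.
Qed.

Lemma poisson_frequency y :
  {ae P, forall w, (\sum_(i < n) (Y i w == y)%:R) / n%:R @[n --> \oo] --> g y}.
Proof.
have sumE : (\sum_(0 <= k <oo) ((k == y)%:R * g k)%:E = (g y)%:E)%E.
  rewrite (nneseriesD1 (n := y))//=; last first.
    by move=> k _; rewrite lee_fin mulr_ge0 ?poisson_pmf_ge0.
  rewrite eqxx mul1r eseries0 ?adde0// => k _ /negbTE ->; by rewrite mul0r.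
apply: (poisson_strong_law (f := fun k => (k == y)%:R) (M := g y)) => //.
rewrite -sumE; apply: lee_nneseries => k _; rewrite lee_fin.
  by rewrite mulr_ge0 ?poisson_pmf_ge0 ?sqr_ge0.
by case: eqP => _; rewrite ?expr1n ?expr0n.
Qed.

Lemma poisson_tail_average K :
  {ae P, forall w, (\sum_(i < n) poisson_tail_nll lambda K (Y i w)) / n%:R @[n --> \oo]
    --> poisson_tail_entropy lambda K}.
Proof.
apply: poisson_strong_law.
- exact: poisson_tail_nll_ge0.
- exact: poisson_tail_entropyE.
- exact: (poisson_exp_moment lambda0 (poisson_tail_nll2_le_exp lambda0 K)).
Qed.

End PoissonSample.

(** * Consistency *)

Section Consistency.
Variables (R : realType) (lambda : R).
Hypothesis lambda0 : 0 < lambda.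
Let g := poisson_pmf lambda.

Let g0 k : 0 < g k := poisson_pmf_gt0 lambda0 k.

(** The bound [ln s <= s - 1] at the square root of the ratio; this brings in the Hellinger
    distance. *)
Lemma lnB_le_sqrt (a b : R) : 0 < a -> 0 < b ->
  ln a - ln b <= 2 * (Num.sqrt (a / b) - 1).
Proof.
move=> a0 b0; have ab0 : 0 < a / b by rewrite divr_gt0.
have s0 : 0 < Num.sqrt (a / b) by rewrite sqrtr_gt0.
rewrite -ln_div ?posrE// -{1}(sqr_sqrtr (ltW ab0)) lnXn// -[ln _ *+ 2]mulr_natl.
by rewrite ler_pM2l// ln_leB1.
Qed.

(** Deterministic for each sample. With [h = sqrt (f / g)], the squared difference of roots is
    [f - g - 2 g (h - 1)]; replacing [g] by the frequency [q] costs the middle term, and the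
    likelihood comparison bounds what remains. *)
Lemma hellinger_le_freq (n K : nat) (Y : 'I_n -> nat) (mu p : R)
    (q := fun y => (\sum_(i < n) (Y i == y)%:R) / n%:R : R) :
  (0 < n)%N -> 0 < mu -> 0 < p <= 1 ->
  (enb_loglik Y lambda 1 <= enb_loglik Y mu p)%E ->
  \sum_(y < K) (Num.sqrt (enb_pmf mu p y) - Num.sqrt (g y)) ^+ 2 <=
  1 - \sum_(y < K) g y
    + 2 * (\sum_(y < K) `|q y - g y| * ((Num.sqrt (g y))^-1 + 1))
    + (\sum_(i < n) poisson_tail_nll lambda K (Y i)) / n%:R.
Proof.
move=> n0 mu0 p01; rewrite !enb_loglik_EFin ?ltr01 ?lexx// lee_fin.
rewrite -subr_ge0 -sumrB.
pose f y := enb_pmf mu p y; pose h y := Num.sqrt (f y / g y).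
have par : enb_param mu p by split => //; exact: ltW.
have f0 y : 0 < f y by exact: enb_pmf_gt0.
have f1 y : f y <= 1 by exact: enb_pmf_le1.
have nR : 0 < n%:R :> R by rewrite ltr0n.
have term i : ln (f (Y i)) - ln (enb_pmf lambda 1 (Y i)) <=
    \sum_(y < K) (Y i == y)%:R * (2 * (h y - 1)) + poisson_tail_nll lambda K (Y i).
  rewrite enb_pmf1E// /poisson_tail_nll; case: leqP => YK.
    rewrite big1 ?add0r ?mul1r; last first.
      by move=> y _; rewrite gtn_eqF ?mul0r// (leq_trans _ YK).
    by rewrite gerDr ln_le0.
  rewrite mul0r addr0 (bigD1 (Ordinal YK))//= eqxx mul1r big1 ?addr0.
    exact: lnB_le_sqrt.
  move=> y yY; rewrite (_ : (Y i == y) = false) ?mul0r//.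
  by apply: contraNF yY => /eqP YE; apply/eqP/val_inj.
move=> /le_trans /(_ (ler_sum _ (fun i _ => term i))).
rewrite big_split/= exchange_big/=.
under eq_bigr do rewrite -mulr_suml.
set L := \sum_(i < n) _; set A := \sum_(y < K) _ => H.
have {}H : 0 <= \sum_(y < K) q y * (2 * (h y - 1)) + L / n%:R.
  rewrite (_ : \sum_(y < K) _ = A / n%:R); last first.
    by rewrite /A mulr_suml; apply: eq_bigr => y _; rewrite /q mulrAC.
  by rewrite -mulrDl divr_ge0// ltW.
apply: (@le_trans _ _ (\sum_(y < K) (f y - g y
    + 2 * (`|q y - g y| * ((Num.sqrt (g y))^-1 + 1)) - q y * (2 * (h y - 1))))).
  apply: ler_sum => y _; rewrite -/(f y).
  have sg0 : 0 < Num.sqrt (g y) by rewrite sqrtr_gt0.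
  have sf0 : 0 < Num.sqrt (f y) by rewrite sqrtr_gt0.
  have gE : Num.sqrt (g y) ^+ 2 = g y by rewrite sqr_sqrtr ?ltW.
  have fE : Num.sqrt (f y) ^+ 2 = f y by rewrite sqr_sqrtr ?ltW.
  have hE : h y = Num.sqrt (f y) / Num.sqrt (g y).
    by rewrite /h sqrtrM ?sqrtrV ?ltW.
  have ghE : g y * h y = Num.sqrt (f y) * Num.sqrt (g y).
    by rewrite hE -{1}gE; field; rewrite gt_eqF.
  (* Uniform in the fitted parameters, since [f y <= 1]. *)
  have habs : `|h y - 1| <= (Num.sqrt (g y))^-1 + 1.
    apply: (le_trans (ler_normB _ _)); rewrite normr1 lerD2r ger0_norm ?sqrtr_ge0//.
    by rewrite hE ler_piMl ?invr_ge0 ?sqrtr_ge0// -(sqrtr1 R) ler_sqrt// f1.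
  have : (q y - g y) * (h y - 1) <= `|q y - g y| * ((Num.sqrt (g y))^-1 + 1).
    apply: (le_trans (ler_norm _)); rewrite normrM; exact: ler_wpM2l.
  rewrite sqrrB fE gE -ghE mulr2n; set B := _ * (_ + 1); lra.
rewrite big_split/= big_split/= sumrN sumrB -mulr_sumr.
have := enb_pmf_sum_le1 K par; rewrite -/f.
lra.
Qed.

Lemma poisson_pmf_sum_cvg : \sum_(y < K) g y @[K --> \oo] --> (1 : R).
Proof.
have -> : (fun K => \sum_(y < K) g y) =
    (fun K => series (exp_coeff lambda) K * expR (- lambda)).
  apply/funext => K; rewrite /series/= big_mkord mulr_suml.
  by apply: eq_bigr => y _; rewrite /g /poisson_pmf lambda0.
rewrite -[X in _ --> X](expRxMexpNx_1 lambda); apply: cvgM; last exact: cvg_cst.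
by rewrite /expR; exact: is_cvg_series_exp_coeff.
Qed.

Lemma enb_mle_pmf_cvg (Y : nat -> nat) (mu p : nat -> R) :
  (\forall n \near \oo, 0 < mu n /\ 0 < p n <= 1) ->
  (forall n, (0 < n)%N ->
    (enb_loglik (fun i : 'I_n => Y i) lambda 1 <=
     enb_loglik (fun i : 'I_n => Y i) (mu n) (p n))%E) ->
  (forall y, (\sum_(i < n) (Y i == y)%:R) / n%:R @[n --> \oo] --> g y) ->
  (forall K, (\sum_(i < n) poisson_tail_nll lambda K (Y i)) / n%:R @[n --> \oo]
    --> poisson_tail_entropy lambda K) ->
  forall y, enb_pmf (mu n) (p n) y @[n --> \oo] --> g y.
Proof.
move=> par mle freq tail y.
(* Squaring the roots recovers the masses once the parameters are in the domain. *)
suff sq : Num.sqrt (enb_pmf (mu n) (p n) y) @[n --> \oo] --> Num.sqrt (g y).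
  have sq2 : Num.sqrt (enb_pmf (mu n) (p n) y) ^+ 2 @[n --> \oo] --> g y.
    rewrite -[X in _ --> X](sqr_sqrtr (ltW (g0 y))) expr2.
    by under eq_cvg do rewrite expr2; exact: cvgM.
  apply: cvg_trans sq2; apply: near_eq_cvg; near=> n.
  have [mu0 p01] : 0 < mu n /\ 0 < p n <= 1 by near: n.
  by rewrite /= sqr_sqrtr// ltW// enb_pmf_gt0.
apply/cvgrPdist_lt => e e0.
(* The limit in [n] of the Hellinger bound at fixed [K]; [K] is fixed first to make it small, and
   only then [n] grows. *)
pose E K := 1 - \sum_(y < K) g y + 2 * 0 + poisson_tail_entropy lambda K.
have Ecvg : E K @[K --> \oo] --> (0 : R).
  rewrite [X in _ --> X](_ : 0 = 1 - 1 + 2 * 0 + 0); last by ring.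
  apply: cvgD; last exact: (poisson_tail_entropy_cvg0 lambda0).
  apply: cvgD; last exact: cvg_cst.
  by apply: cvgB; [exact: cvg_cst|exact: poisson_pmf_sum_cvg].
have [K [yK EK]] : exists K, (y < K)%N /\ E K < e ^+ 2.
  have : \forall K \near \oo, (y < K)%N /\ E K < e ^+ 2.
    near=> K; split; first by near: K; exact: nbhs_infty_gt.
    near: K; apply: (cvgr_lt 0) => //; exact: exprn_gt0.
  by move=> [N _ /(_ N (leqnn N))]; exists N.
pose B n := 1 - \sum_(y < K) g y
    + 2 * (\sum_(y < K) `|(\sum_(i < n) (Y i == y)%:R) / n%:R - g y| *
        ((Num.sqrt (g y))^-1 + 1))
    + (\sum_(i < n) poisson_tail_nll lambda K (Y i)) / n%:R.
have Bcvg : B n @[n --> \oo] --> E K.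
  apply: cvgD; last exact: tail.
  apply: cvgD; first exact: cvg_cst.
  apply: cvgM; first exact: cvg_cst.
  rewrite [X in _ --> X](_ : 0 = \sum_(z < K) 0); last by rewrite big1.
  apply: (cvg_big (op := +%R)) => [|z _]; first exact: add_continuous.
  rewrite -[X in _ --> X](mul0r ((Num.sqrt (g z))^-1 + 1)).
  apply: cvgM; last exact: cvg_cst.
  by apply/norm_cvg0P/subr_cvg0; exact: freq.
near=> n.
have [mu0 p01] : 0 < mu n /\ 0 < p n <= 1 by near: n.
have n0 : (0 < n)%N by near: n; exact: nbhs_infty_gt.
have Bn : B n < e ^+ 2 by near: n; exact: (cvgr_lt (E K)).
rewrite distrC -ltr_sqr ?nnegrE ?normr_ge0 ?(ltW e0)// real_normK ?num_real//.
apply: le_lt_trans Bn; apply: le_trans (hellinger_le_freq K n0 mu0 p01 (mle n n0)).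
rewrite (bigD1 (Ordinal yK))//= lerDl; apply: sumr_ge0 => z _; exact: sqr_ge0.
Unshelve. all: by end_near. Qed.

Lemma enb_mle_p_cvg1 (Y : nat -> nat) (mu p : nat -> R) :
  (forall n, (0 < n)%N -> is_enb_mle (fun i : 'I_n => Y i) (mu n) (p n)) ->
  (forall y, (\sum_(i < n) (Y i == y)%:R) / n%:R @[n --> \oo] --> g y) ->
  (forall K, (\sum_(i < n) poisson_tail_nll lambda K (Y i)) / n%:R @[n --> \oo]
    --> poisson_tail_entropy lambda K) ->
  p n @[n --> \oo] --> (1 : R).
Proof.
move=> mle freq tail.
(* The fitted mean is the sample mean, at least the frequency of the value 1, which tends to
   [g 1 > 0]. *)
have par : \forall n \near \oo, 0 < mu n /\ 0 < p n <= 1.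
  near=> n.
  have n0 : (0 < n)%N by near: n; exact: nbhs_infty_gt.
  split; last by have [[]] := mle n n0.
  rewrite (enb_mle_mean n0 (mle n n0)) mulr_gt0 ?invr_gt0 ?ltr0n//.
  have : 0 < (\sum_(i < n) (Y i == 1)%:R) / n%:R :> R.
    by near: n; apply: (cvgr_gt (g 1)).
  rewrite pmulr_lgt0 ?invr_gt0 ?ltr0n// => /lt_le_trans; apply.
  by apply: ler_sum => i _; rewrite ler_nat; case: (Y i) => [|[]].
have P1 : enb_param lambda 1 by split; [exact: ltW|rewrite ltr01 lexx].
have f := enb_mle_pmf_cvg par (fun n n0 => (mle n n0).2 _ _ P1) freq tail.
have gn0 k : g k != 0 by rewrite gt_eqF.
suff : 1 - p n @[n --> \oo] --> (0 : R).
  move=> h; rewrite -(subr0 1).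
  rewrite (_ : p = fun n => 1 - (1 - p n)); last by apply/funext => n; rewrite subKr.
  by apply: cvgB => //; exact: cvg_cst.
(* At [(lambda, 1)] the ratio identity says that the limiting expression in [g] is 0. *)
have := enb_pmf_ratio lambda0 (introT andP (conj (ltr01 : 0 < 1 :> R) (lexx 1))).
rewrite subrr !enb_pmf1E// => ->.
have : 2 * enb_pmf (mu n) (p n) 2 / enb_pmf (mu n) (p n) 1 -
    enb_pmf (mu n) (p n) 1 / enb_pmf (mu n) (p n) 0 @[n --> \oo] -->
    2 * g 2 / g 1 - g 1 / g 0.
  apply: cvgB; apply: cvgM; do ?[by apply: cvgV; [exact: gn0|exact: f]|exact: f].
  by apply: cvgM; [exact: cvg_cst|exact: f].
move=> ratio; apply: (cvg_trans _ ratio); apply: near_eq_cvg; near=> n.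
have [mu0 p01] : 0 < mu n /\ 0 < p n <= 1 by near: n.
by rewrite /= -enb_pmf_ratio.
Unshelve. all: by end_near. Qed.

End Consistency.

Theorem theorem4p5 (R : realType) :
  (forall (n : nat) (Y : 'I_n -> nat) (muhat phat : R),
     (0 < n)%N -> is_enb_mle Y muhat phat ->
     (muhat = 0 <-> sample_mean R Y = 0) /\ muhat = sample_mean R Y) /\
  (forall (d : measure_display) (Omega : measurableType d)
     (P : probability Omega R) (lambda : R) (Y : nat -> {RV P >-> nat})
     (muhat phat : nat -> Omega -> R),
     0 < lambda -> iid_poisson lambda Y ->
     (forall (n : nat) (w : Omega), (0 < n)%N ->
        is_enb_mle (fun i : 'I_n => Y i w) (muhat n w) (phat n w)) ->
     {ae P, forall w, phat n w @[n --> \oo] --> (1 : R)}).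
Proof.
split=> [n Y muhat phat n0 /(enb_mle_mean n0) -> //|].
move=> d Omega P lambda Y muhat phat lambda0 iidY mle.
(* Countably many null sets, over [y] and over [K], are discarded; off them the argument is
   pathwise. *)
have freq := ae_foralln (poisson_frequency iidY).
have tail := ae_foralln (poisson_tail_average lambda0 iidY).
apply: filterS2 freq tail => w freq tail.
apply: (enb_mle_p_cvg1 lambda0 (Y := fun i => Y i w)).
- exact: (fun n => mle n w).
- exact: freq.
- exact: tail.
Qed.
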